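(* Let $q$ be a prime power and let $n=q^2+q+1$. Then $$\left\lceil \frac{q}{2}\right\rceil n\le \psi'_c(K_n).$$
   Context: $K_n$ is the complete graph on $n$ vertices and $[k]=\{1,\dots,k\}$. For a finite simple graph $H$, a complete $k$-coloring of $H$ is a (not necessarily proper) map $\varsigma\colon V(H)\to[k]$ such that for each pair of different colors $i,j\in[k]$ there is an edge $xy\in E(H)$ with $x\in\varsigma^{-1}(i)$ and $y\in\varsigma^{-1}(j)$. It is connected if each color class $\varsigma^{-1}(i)$ induces a connected subgraph of $H$. For a connected graph $H$, $\psi_c(H)$ is the largest $k$ for which $H$ has a connected and complete $k$-coloring. The connected-pseudoachromatic index of a graph $G$ is $\psi'_c(G)=\psi_c(L(G))$, where $L(G)$ is the line graph of $G$. Equivalently, $\psi'_c(K_n)$ is the largest $k$ for which the edges of $K_n$ can be colored with $k$ colors so that each color class of edges forms a connected subgraph and every two color classes share at least one vertex. *)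

(* Defs.v *)
From mathcomp Require Import all_boot.

Set Implicit Arguments.
Unset Strict Implicit.
Unset Printing Implicit Defensive.

Record sgraph := SGraph {
  vertex :> finType;
  adj : rel vertex;
  adj_sym : symmetric adj;
  adj_irr : irreflexive adj
}.

Section CompleteGraph.
Variable n : nat.
Definition complete_adj : rel 'I_n := [rel x y | x != y].
Fact complete_adj_sym : symmetric complete_adj.
Proof. by move=> x y; rewrite /complete_adj /= eq_sym. Qed.
Fact complete_adj_irr : irreflexive complete_adj.
Proof. by move=> x; rewrite /complete_adj /= eqxx. Qed.
Definition complete_graph := SGraph complete_adj_sym complete_adj_irr.
End CompleteGraph.

Section LineGraph.
Variable G : sgraph.
Definition edges : {set {set G}} :=
  [set e | [exists x : G, exists y : G, adj x y && (e == [set x; y])]].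
Definition line_vertex : finType := {e : {set G} | e \in edges}.
Definition line_adj : rel line_vertex :=
  [rel e f | (e != f) && (val e :&: val f != set0)].
Fact line_adj_sym : symmetric line_adj.
Proof. by move=> e f; rewrite /line_adj /= eq_sym setIC. Qed.
Fact line_adj_irr : irreflexive line_adj.
Proof. by move=> e; rewrite /line_adj /= eqxx. Qed.
Definition line_graph := SGraph line_adj_sym line_adj_irr.
End LineGraph.

Section Colorings.
Variable H : sgraph.

(* The subgraph induced by A is connected; connected graphs are nonempty. *)
Definition induces_connected (A : {set H}) : bool :=
  (A != set0) &&
  [forall x in A, forall y in A,
     connect [rel u v | [&& u \in A, v \in A & adj u v]] x y].

Section Fixed.
Variables (k : nat) (c : {ffun H -> 'I_k}).

Definition color_class (i : 'I_k) : {set H} := [set x | c x == i].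

Definition complete_coloring : bool :=
  [forall i, forall j, (i != j) ==>
     [exists x in color_class i, exists y in color_class j, adj x y]].

Definition connected_coloring : bool :=
  [forall i, induces_connected (color_class i)].
End Fixed.

Definition has_conn_complete_coloring (k : nat) : bool :=
  [exists c : {ffun H -> 'I_k}, connected_coloring c && complete_coloring c].

(* Color classes are nonempty, so no k above #|H| is attained and the bound on
   the range loses nothing (psi_c_max); psi_c is 0 when no k is attained, which
   can happen only for disconnected H. *)
Definition psi_c : nat :=
  \max_(k < #|H|.+1 | has_conn_complete_coloring k) k.

Lemma conn_complete_coloring_card k :
  has_conn_complete_coloring k -> k <= #|H|.
Proof.
case/existsP=> c /andP[/forallP cc _].
have /fin_all_exists[f fP] (i : 'I_k) : exists x, c x = i.
  by have /andP[/set0Pn[x]] := cc i; rewrite inE => /eqP; exists x.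
by rewrite -[k]card_ord; apply: (@leq_card _ _ f); apply: can_inj fP.
Qed.

Lemma psi_c_max k : has_conn_complete_coloring k -> k <= psi_c.
Proof.
move=> hk; have lk := conn_complete_coloring_card hk.
exact: (@leq_bigmax_cond _ _ (fun i : 'I_#|H|.+1 => nat_of_ord i)
          (Ordinal (lk : k < #|H|.+1)) hk).
Qed.

Lemma psi_c_attained k :
  has_conn_complete_coloring k -> has_conn_complete_coloring psi_c.
Proof.
move=> hk; have lk := conn_complete_coloring_card hk.
by rewrite /psi_c (bigmax_eq_arg (Ordinal (lk : k < #|H|.+1))) //; case: arg_maxnP.
Qed.
End Colorings.

Definition connected_pseudoachromatic_index (G : sgraph) : nat :=
  psi_c (line_graph G).

Definition prime_power (q : nat) : Prop :=
  exists p e : nat, [/\ prime p, 0 < e & q = p ^ e].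

(* Main.v *)
Require Import Defs.
From mathcomp Require Import all_boot.
From mathcomp Require Import ssralg finalg finfield.
From mathcomp Require Import ring zify.

(** A projective plane of order q has n = q^2 + q + 1 points, as many lines,
    and q + 1 points on each line.  Identify the vertices of K_n with the
    points.  Each edge spans exactly one line, so the edges of K_n split into n
    complete graphs K_(q+1), one for each line.  Colour the edges of each
    of these with its own (q + 1)./2 = uphalf q colours, in such a way that each
    colour class is connected and reaches all the points of the line
    ([mem_half_color]).  Any two lines meet, and a common point of two lines
    lies on edges of every colour of either line; hence any two colour classes
    share a vertex ([linear_space_bound]).

    To colour K_m with m./2 colours, group the vertices into pairs 2c, 2c+1
    ([half_color]).  Colour c consists of the edge inside the pair c, called the
    hub, and of edges that touch it, which makes the class connected at once.
    The four edges between two pairs c < d are shared: two disjoint ones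
    (between ends of equal parity) go to c and join both ends of d to the hub
    of c, the two others go to d and join both ends of c to the hub of d.  If m
    is odd, one vertex is left over, and its edges to the pair c go to c.

    The plane is the projective plane over the field F with q elements, with
    points and lines in coordinates: q^2 affine points, q directions and the
    vertical direction. *)

Set Implicit Arguments.
Unset Strict Implicit.
Unset Printing Implicit Defensive.

(** * Colourings of the edges of a graph *)

Lemma edgesP (G : sgraph) (e : {set G}) :
  reflect (exists x y, adj x y /\ e = [set x; y]) (e \in edges G).
Proof.
rewrite inE; apply: (iffP existsP) => [[x /existsP[y /andP[xy /eqP->]]]|].
  by exists x, y.
by move=> [x [y [xy ->]]]; exists x; apply/existsP; exists y; rewrite xy eqxx.
Qed.

(** A colour class with a hub edge that all its edges touch is connected in the
    line graph.  The colour of an edge is a function of its ordered pair of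
    ends, which is easier to define than a function of the edge. *)
Lemma hub_coloring_bound (G : sgraph) (C : finType) (f : G -> G -> C) :
  (forall x y, adj x y -> f x y = f y x) ->
  (forall c, exists x y, [/\ adj x y, f x y = c &
     forall u v, adj u v -> f u v = c -> (u \in [set x; y]) || (v \in [set x; y])]) ->
  (forall c d, exists p x y, [/\ adj p x, adj p y, f p x = c & f p y = d]) ->
  #|C| <= connected_pseudoachromatic_index G.
Proof.
move=> fC hub meet; apply: psi_c_max.
have ex_color (e : line_graph G) : exists i : 'I_#|C|, forall x y,
    adj x y -> val e = [set x; y] -> i = enum_rank (f x y).
  case: e => e /= he; have [x [y [xy ->]]] := edgesP _ he.
  exists (enum_rank (f x y)) => u v uv E.
  have nuv : u != v by apply: contraTneq uv => ->; rewrite adj_irr.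
  have : u \in [set x; y] by rewrite E set21.
  have : v \in [set x; y] by rewrite E set22.
  rewrite !inE => /orP[]/eqP vE /orP[]/eqP uE; rewrite uE vE ?eqxx // in nuv *.
  by rewrite fC.
have [g gP] := fin_all_exists ex_color.
have edge x y (xy : adj x y) :
    exists2 e : line_graph G, val e = [set x; y] & g e = enum_rank (f x y).
  have he : [set x; y] \in edges G by apply/edgesP; exists x, y.
  by exists (exist (fun e => e \in edges G) _ he : line_vertex G) => //; apply: gP.
apply/existsP; exists (finfun g); apply/andP; split.
  apply/forallP=> i; have [x [y [xy fi touch]]] := hub (enum_val i).
  have [h hE gh] := edge _ _ xy.
  have gh_i : g h = i by rewrite gh fi enum_valK.
  apply/andP; split; first by apply/set0Pn; exists h; rewrite inE ffunE gh_i.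
  pose r := [rel u v | [&& u \in color_class (finfun g) i,
    v \in color_class (finfun g) i & @adj (line_graph G) u v]].
  have to_hub e : g e = i -> connect r e h.
    move=> ge; case: (eqVneq e h) => [-> // | neq].
    apply: connect1; rewrite /r /= !inE !ffunE ge gh_i eqxx /=.
    apply/andP; split; first exact: neq.
    have [u [v [uv eE]]] := edgesP _ (valP e).
    have fuv : f u v = enum_val i.
      by rewrite -ge (gP _ _ _ uv eE) enum_rankK.
    apply/set0Pn; case/orP: (touch _ _ uv fuv) => hxy;
      [exists u | exists v]; by rewrite eE hE in_setI hxy ?set21 ?set22.
  have r_sym : symmetric r.
    by move=> u v /=; rewrite andbCA line_adj_sym.
  apply/forallP=> a; apply/implyP; rewrite inE ffunE => /eqP ga.
  apply/forallP=> b; apply/implyP; rewrite inE ffunE => /eqP gb.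
  apply: connect_trans (to_hub _ ga) _.
  by rewrite (sym_connect_sym r_sym) to_hub.
apply/forallP=> i; apply/forallP=> j; apply/implyP=> nij.
have [p [x [y [px py fi fj]]]] := meet (enum_val i) (enum_val j).
have [a aE ga] := edge _ _ px; have [b bE gb] := edge _ _ py.
rewrite fi enum_valK in ga; rewrite fj enum_valK in gb.
apply/existsP; exists a; rewrite inE ffunE ga eqxx /=.
apply/existsP; exists b; rewrite inE ffunE gb eqxx /=.
apply/andP; split; first by apply: contraNneq nij => ab; rewrite -ga -gb ab.
by apply/set0Pn; exists p; rewrite aE bE !inE eqxx.
Qed.

(** * Spanning connected colour classes in a complete graph *)

(** The second test singles out the edges at the vertex m.-1 when m is odd: it
    is the only vertex whose half is not a colour. *)
Definition half_color (m i j : nat) : nat :=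
  if (odd i == odd j) || (maxn i./2 j./2 == m./2)
  then minn i./2 j./2 else maxn i./2 j./2.

Lemma half_colorC m i j : half_color m i j = half_color m j i.
Proof. by rewrite /half_color eq_sym minnC maxnC. Qed.

Lemma half_color_lt m i j :
  i < m -> j < m -> i != j -> half_color m i j < m./2.
Proof. rewrite /half_color; case: ifP; lia. Qed.

Lemma half_color_hub m c : c < m./2 -> half_color m c.*2 c.*2.+1 = c.
Proof. rewrite /half_color; case: ifP; lia. Qed.

Lemma half_color_touch m i j c : half_color m i j = c ->
  [|| i == c.*2, i == c.*2.+1, j == c.*2 | j == c.*2.+1].
Proof. rewrite /half_color; case: ifP; lia. Qed.

(** Each colour class spans K_m: this is what makes the classes of two lines
    share the common point of these lines, whatever their colours. *)
Lemma mem_half_color m c i : c < m./2 -> i < m ->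
  exists2 j, j < m & (i != j) && (half_color m i j == c).
Proof.
move=> ct im; case: (ltngtP i./2 c) => ic.
- exists (c.*2 + ~~ odd i); rewrite /half_color; last case: ifP; lia.
- exists (c.*2 + odd i); rewrite /half_color; last case: ifP; lia.
- exists (c.*2 + ~~ odd i); rewrite /half_color; last case: ifP; lia.
Qed.

(** * Linear spaces whose lines meet pairwise *)

(** Here P and L are the points and the lines of the space.  Two colours of one
    line share any point of it, as do colours of distinct lines their common
    point, so the second hypothesis also covers l = l', where it says that lines
    are not empty. *)
Lemma linear_space_bound (P L : finType) (m : nat) (line : L -> {set P})
    (join : P -> P -> L) :
  (forall x y l, x != y -> (x \in line l) && (y \in line l) = (l == join x y)) ->
  (forall l l', exists p, p \in line l :&: line l') ->
  (forall l, #|line l| = m) ->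
  m./2 * #|L| <= connected_pseudoachromatic_index (complete_graph #|P|).
Proof.
move=> joinP meet card_line.
case Dt : m./2 => [//|t].
pose idx l x := index x (enum (line l)).
have idx_lt l x : x \in line l -> idx l x < m.
  by rewrite -mem_enum -index_mem -cardE card_line.
have idx_inj l x y : x \in line l -> y \in line l -> idx l x = idx l y -> x = y.
  by move=> xl yl; apply: (index_inj x); rewrite mem_enum.
have idx_ex l i : i < m -> exists2 x, x \in line l & idx l x = i.
  move=> im; have [x0 _] := meet l l.
  have il : i < size (enum (line l)) by rewrite -cardE card_line.
  exists (nth x0 (enum (line l)) i); first by rewrite -mem_enum mem_nth.
  by rewrite /idx index_uniq ?enum_uniq.
pose hc l x y := half_color m (idx l x) (idx l y).
pose f x y : L * 'I_t.+1 := (join x y, inord (hc (join x y) x y)).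
have fE l c x y : x \in line l -> y \in line l -> x != y -> hc l x y = c ->
    forall ct : c < t.+1, f x y = (l, Ordinal ct).
  move=> xl yl nxy hcE ct; rewrite /f.
  have /eqP <- : l == join x y by rewrite -joinP // xl yl.
  by rewrite hcE; congr pair; apply: val_inj; rewrite /= inordK.
have fI l c x y : x != y -> f x y = (l, c) ->
    [/\ x \in line l, y \in line l & hc l x y = c].
  move=> nxy [lE cE]; have /andP[xl yl] : (x \in line l) && (y \in line l).
    by rewrite joinP // lE.
  split=> //; rewrite -cE lE inordK // -Dt half_color_lt ?idx_lt //.
  by apply: contraNneq nxy => /idx_inj->.
pose g (x y : complete_graph #|P|) := f (enum_val x) (enum_val y).
have adjE (x y : P) : @adj (complete_graph #|P|) (enum_rank x) (enum_rank y) = (x != y).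
  by rewrite -(inj_eq enum_rank_inj).
have adjV (x y : complete_graph #|P|) : adj x y -> enum_val x != enum_val y.
  by rewrite (inj_eq enum_val_inj).
have -> : t.+1 * #|L| = #|{: L * 'I_t.+1}| by rewrite card_prod card_ord mulnC.
apply: (@hub_coloring_bound _ _ g).
- move=> x y /adjV nxy; rewrite /g.
  case E: (f (enum_val x) (enum_val y)) => [l [c ct]].
  have [xl yl hE] := fI _ _ _ _ nxy E.
  by rewrite (fE l c) // 1?eq_sym // /hc half_colorC.
- move=> [l [c ct]]; have ct' : c < m./2 by rewrite Dt.
  have [|x xl xE] := idx_ex l c.*2; first by lia.
  have [|y yl yE] := idx_ex l c.*2.+1; first by lia.
  have nxy : x != y by apply: contra_eq_neq xE => ->; rewrite yE; lia.
  exists (enum_rank x), (enum_rank y); split; first by rewrite adjE.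
    by rewrite /g !enum_rankK (fE l c) // /hc xE yE half_color_hub.
  move=> u v /adjV nuv /(fI _ _ _ _ nuv)[ul vl /half_color_touch].
  have eq_idx a b : enum_val a \in line l -> b \in line l ->
      (idx l (enum_val a) == idx l b) = (a == enum_rank b).
    move=> al bl; apply/eqP/eqP=> [/idx_inj <- // | ->]; rewrite ?enum_valK //.
    by rewrite enum_rankK.
  by rewrite !inE /= -yE -xE !eq_idx // orbA.
- move=> [l [c ct]] [l' [c' ct']].
  have [p /setIP[pl pl']] := meet l l'.
  have nbr k d (dt : d < t.+1) : p \in line k ->
      exists2 x, p != x & f p x = (k, Ordinal dt).
    move=> pk; have dm : d < m./2 by rewrite Dt.
    have [j jm /andP[nj /eqP hE]] := mem_half_color dm (idx_lt _ _ pk).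
    have [x xk xE] := idx_ex k j jm.
    have npx : p != x by apply: contraNneq nj => ->; rewrite xE.
    by exists x => //; apply: fE => //; rewrite /hc xE.
  have [x nx fx] := nbr _ _ ct pl; have [y ny fy] := nbr _ _ ct' pl'.
  exists (enum_rank p), (enum_rank x), (enum_rank y).
  by rewrite !adjE /g !enum_rankK.
Qed.

(** * The projective plane over a finite field *)

Section ProjectivePlane.
Import GRing.Theory.
Local Open Scope ring_scope.
Variable F : finFieldType.

(** [inl (x, y)] is an affine point, [inr (Some s)] the direction of slope s,
    [inr None] the vertical direction.  The same type serves for lines:
    [inl (a, b)] is the line y = a x - b, [inr (Some c)] the line x = c, and
    [inr None] the line at infinity.  The sign of b makes [incident]
    symmetric, so that [joinP] also gives the common point of two lines. *)
Definition plane_elt : finType := (F * F + option F)%type.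

Definition incident (p l : plane_elt) : bool :=
  match p, l with
  | inl (x, y), inl (a, b) => y + b == x * a
  | inl (x, _), inr u | inr u, inl (x, _) => u == Some x
  | inr u, inr v => (u == None) || (v == None)
  end.

Definition join (p p' : plane_elt) : plane_elt :=
  match p, p' with
  | inl (x, y), inl (x', y') =>
      if x == x' then inr (Some x)
      else let a := (y - y') / (x - x') in inl (a, x * a - y)
  | inl (x, y), inr (Some s) | inr (Some s), inl (x, y) => inl (s, x * s - y)
  | inl (x, _), inr None | inr None, inl (x, _) => inr (Some x)
  | inr _, inr _ => inr None
  end.

Lemma incidentC p l : incident p l = incident l p.
Proof.
by case: p l => [[x y]|u] [[a b]|v] //=; rewrite 1?orbC // addrC mulrC.
Qed.

(** Existence and uniqueness of the line through two points, as one equality of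
    booleans. *)
Lemma joinP p p' l :
  p != p' -> incident p l && incident p' l = (l == join p p').
Proof.
have affine_dir (x y s a b : F) :
    (y + b == x * a) && (s == a) = (inl (a, b) == inl (s, x * s - y) :> plane_elt).
  apply/andP/eqP=> [[/eqP E /eqP->]|[-> ->]]; last by rewrite addrC subrK !eqxx.
  by rewrite -E addrAC subrr add0r.
case: p p' l => [[x y]|[s|]] [[x' y']|[s'|]] [[a b]|[c|]] //= npp'.
- case: (eqVneq x x') npp' => [<-|nx] npp'.
    apply/andP=> -[/eqP E]; rewrite -E => /eqP/addIr Ey.
    by rewrite Ey eqxx in npp'.
  have dx : x - x' != 0 by rewrite subr_eq0.
  rewrite -affine_dir; apply/andP/andP=> -[/eqP E /eqP E']; split; apply/eqP=> //.
    by apply: (canLR (mulfK dx)); rewrite mulrBr ![a * _]mulrC -E -E'; ring.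
  by rewrite -E' in E *; apply: (addrI (y - y')); transitivity (y + b);
    [ring | rewrite E; field].
- case: (eqVneq x x') npp' => [<- _|nx _]; first by rewrite andbb.
  by apply/andP=> -[/eqP[->]]; rewrite (inj_eq (@Some_inj _)) (negPf nx).
- by case: ifP.
- exact: affine_dir.
- exact: andbF.
- exact: andbF.
- exact: andbT.
- by rewrite andbC; apply: affine_dir.
- by apply/andP=> -[/eqP[sE] /eqP[s'E]]; rewrite sE s'E eqxx in npp'.
- exact: andbF.
Qed.

(** A bijection from [option F] to the points of [l].  It sends [None] to the
    direction of [l], or to the vertical direction if [l] is the line at
    infinity. *)
Definition point_on (l : plane_elt) (s : option F) : plane_elt :=
  match l, s with
  | inl (a, b), Some x => inl (x, x * a - b)
  | inl (a, _), None => inr (Some a)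
  | inr (Some c), Some y => inl (c, y)
  | inr None, Some m => inr (Some m)
  | inr _, None => inr None
  end.

Lemma card_line l : #|[set p | incident p l]| = #|F|.+1.
Proof.
have inj : injective (point_on l).
  by case: l => [[a b]|[c|]] [x|] [y|] //= [->].
rewrite -card_option -(card_codom inj) cardsE; apply: eq_card => p.
rewrite unfold_in; apply/idP/codomP => [|[s ->]]; last first.
  by case: l s {inj} => [[a b]|[c|]] [x|] //=; rewrite ?subrK.
case: l p {inj} => [[a b]|[c|]] [[x y]|[s|]] //=.
- by move=> /eqP E; exists (Some x); rewrite /= -E addrK.
- by move=> /eqP[->]; exists None.
- by move=> /eqP[->]; exists (Some y).
- by exists None.
- by exists (Some s).
- by exists None.
Qed.

Lemma plane_bound :
  (#|F|.+1./2 * #|plane_elt| <=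
     connected_pseudoachromatic_index (complete_graph #|plane_elt|))%N.
Proof.
apply: (@linear_space_bound _ _ _ (fun l => [set p | incident p l]) join).
- by move=> p p' l; rewrite !inE; apply: joinP.
- move=> l l'; case: (eqVneq l l') => [<-|nll].
    have /card_gt0P[p pl] : (0 < #|[set p | incident p l]|)%N by rewrite card_line.
    by exists p; rewrite setIid.
  exists (join l l'); rewrite !inE !(incidentC (join _ _)).
  by rewrite joinP.
- exact: card_line.
Qed.

End ProjectivePlane.

Theorem theorem3 (q n : nat) (hq : prime_power q) (hn : n = q ^ 2 + q + 1) :
  uphalf q * n <= connected_pseudoachromatic_index (complete_graph n).
Proof.
case: hq => p [e [pp e0 qE]].
have [F _ cardF] := PrimePowerField pp e0.
have -> : n = #|plane_elt F|.
  rewrite card_sum card_prod card_option cardF -qE hn; lia.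
by have := plane_bound F; rewrite cardF -qE.
Qed.
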